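(* Let $X$ be an infinite set, and let $\rho$ be the number of cardinals $\mu$ satisfying $\aleph_0\leq\mu\leq|X|$. (i) $\operatorname{rank}(\mathcal G_X^L:\mathcal G_X)=2+2\rho$. (ii) If $\rho<\aleph_0$, and if $\Omega\subseteq\mathcal G_X^L$ with $|\Omega|=2+2\rho$, then $\mathcal G_X^L=\langle\mathcal G_X\cup\Omega\rangle$ if and only if $\Omega$ can be written as $\Omega=\{\alpha_\mu,\beta_\mu : \mu=1\text{ or }\aleph_0\leq\mu\leq|X|\}$ (indexed by cardinals $\mu$), where for each $\mu$, $h(\alpha_\mu)=s(\beta_\mu)=\mu$ and $s(\alpha_\mu)=h(\beta_\mu)=0$.
   Context: Partial Brauer monoid. Let $X$ be a set and $X'=\{x':x\in X\}$ a disjoint copy of $X$. A Brauer graph is an (undirected) graph with vertex set $X\cup X'$ in which every vertex has degree at most $1$; $\mathcal{PB}_X$ is the set of all of them. Product: let $X''=\{x'':x\in X\}$ be another disjoint copy of $X$; given $\alpha,\beta\in\mathcal{PB}_X$, let $\alpha^\vee$ be $\alpha$ with each vertex $x'$ renamed $x''$, let $\beta^\wedge$ be $\beta$ with each vertex $x\in X$ renamed $x''$, and let $\Pi(\alpha,\beta)$ be the graph on $X\cup X'\cup X''$ with all edges of $\alpha^\vee$ and $\beta^\wedge$. Then $\alpha\beta$ is the graph on $X\cup X'$ with an edge $\{x,y\}$ whenever $x,y\in X\cup X'$ are distinct and lie in the same connected component of $\Pi(\alpha,\beta)$. This makes $\mathcal{PB}_X$ a monoid with identity the graph with edge set $\{\{x,x'\}:x\in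 X\}$. For $\alpha\in\mathcal{PB}_X$, $h(\alpha)$ is the number of upper hooks (edges $\{x,y\}$ with $x,y\in X$ distinct) and $s(\alpha)$ is the number of upper singletons (vertices $x\in X$ of degree $0$); these are cardinals. In a monoid $M$, an element $x$ is a left unit if $ax=1$ for some $a\in M$, and a (two-sided) unit if also $xb=1$ for some $b\in M$. $\mathcal G_X^L$ and $\mathcal G_X$ denote the submonoids of all left units and of all units of $\mathcal{PB}_X$. For a subset $U$ of a semigroup $S$, $\langle U\rangle$ is the subsemigroup generated by $U$. For $A\subseteq S$, the relative rank is $\operatorname{rank}(S:A)=\min\{|U| : U\subseteq S,\ S=\langle A\cup U\rangle\}$. *)

(* Defs.v *)
From HB Require Import structures.
From Stdlib Require Import Relation_Operators Operators_Properties.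
From mathcomp Require Import all_boot.
From mathcomp Require Import boolp classical_sets functions cardinality.

Set Implicit Arguments.
Unset Strict Implicit.
Unset Printing Implicit Defensive.

Local Open Scope classical_set_scope.
Local Open Scope card_scope.

(* In [X + X], [inl x] is the vertex x of X and [inr x] is the vertex x'.     *)
Record brauer_graph (X : Type) := BrauerGraph {
  adj :> X + X -> X + X -> Prop;
  adj_irrefl : forall u, ~ adj u u;
  adj_sym : forall u v, adj u v -> adj v u;
  adj_degree_le1 : forall u v w, adj u v -> adj u w -> v = w
}.

Lemma brauer_graphP X (a b : brauer_graph X) :
  (forall u v, a u v <-> b u v) -> a = b.
Proof.
move=> eqab; have : adj a = adj b.
  by apply/funext => u; apply/funext => v; apply/propext.
case: a b {eqab} => ra ai asy ad [rb bi bs bd] /= eqr; subst rb.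
by congr BrauerGraph; exact: Prop_irrelevance.
Qed.

HB.instance Definition _ X := gen_eqMixin (brauer_graph X).
HB.instance Definition _ X := gen_choiceMixin (brauer_graph X).

(* The vertices x, x'' and x' of the product graph. *)
Inductive pvertex (X : Type) := Upper of X | Middle of X | Lower of X.

Section Product.
Variable X : Type.
Implicit Types a b c : brauer_graph X.

Definition vee (u : X + X) : pvertex X :=
  match u with inl x => Upper x | inr x => Middle x end.

Definition wedge (u : X + X) : pvertex X :=
  match u with inl x => Middle x | inr x => Lower x end.

Definition outer (u : X + X) : pvertex X :=
  match u with inl x => Upper x | inr x => Lower x end.

Inductive product_graph a b : pvertex X -> pvertex X -> Prop :=
| product_vee u v of a u v : product_graph a b (vee u) (vee v)
| product_wedge u v of b u v : product_graph a b (wedge u) (wedge v).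

(* The product graph is undirected, so that the reflexive transitive closure
   of its adjacency relation is "being in the same connected component". *)
Definition connected_in a b : pvertex X -> pvertex X -> Prop :=
  clos_refl_trans _ (product_graph a b).

Definition mul_adj a b (u v : X + X) : Prop :=
  u <> v /\ connected_in a b (outer u) (outer v).

Lemma vee_inj : injective vee.
Proof. by move=> [x|x] [y|y] //= [->]. Qed.

Lemma wedge_inj : injective wedge.
Proof. by move=> [x|x] [y|y] //= [->]. Qed.

Lemma outer_inj : injective outer.
Proof. by move=> [x|x] [y|y] //= [->]. Qed.

Lemma product_graph_sym a b p q : product_graph a b p q -> product_graph a b q p.
Proof. by case=> u v uv; [apply: product_vee|apply: product_wedge]; apply: adj_sym. Qed.

Lemma connected_in_sym a b p q : connected_in a b p q -> connected_in a b q p.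
Proof.
elim=> [{}p {}q pq|{}p|{}p {}q r _ qp _ rq].
- exact/rt_step/product_graph_sym.
- exact: rt_refl.
- exact: rt_trans rq qp.
Qed.

Lemma mul_adj_irrefl a b u : ~ mul_adj a b u u.
Proof. by case. Qed.

Lemma mul_adj_sym a b u v : mul_adj a b u v -> mul_adj a b v u.
Proof. by case=> uv /connected_in_sym vu; split=> // /esym. Qed.

(* The edges of a given colour: [true] for a and [false] for b. *)
Definition coloured a b (k : bool) (p q : pvertex X) : Prop :=
  if k then exists u v, [/\ a u v, p = vee u & q = vee v]
  else exists u v, [/\ b u v, p = wedge u & q = wedge v].

Lemma colouredP a b p q :
  product_graph a b p q <-> exists k, coloured a b k p q.
Proof.
split=> [[u v uv|u v uv]|[[] /= [u [v [uv -> ->]]]]].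
- by exists true, u, v.
- by exists false, u, v.
- exact: product_vee.
- exact: product_wedge.
Qed.

Lemma coloured_fun a b k p q r :
  coloured a b k p q -> coloured a b k p r -> q = r.
Proof.
case: k => /= -[u [v [uv -> ->]]] [u' [w [uw e ->]]].
  by move/vee_inj: e uw => <- uw; rewrite (adj_degree_le1 uv uw).
by move/wedge_inj: e uw => <- uw; rewrite (adj_degree_le1 uv uw).
Qed.

Lemma coloured_sym a b k p q : coloured a b k p q -> coloured a b k q p.
Proof.
by case: k => /= -[u [v [uv -> ->]]]; exists v, u; split=> //; apply: adj_sym.
Qed.

Lemma coloured_outer a b k k' u p q :
  coloured a b k (outer u) p -> coloured a b k' (outer u) q -> k = k'.
Proof. by case: k k' u => -[] [] // x /= -[[y|y] [? []]] // ? ? ? [[z|z] [? []]]. Qed.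

(* [alternating a b p0 n k q]: some walk of n.+1 edges of alternating colours
   leads from p0 to q, with last edge of colour k. *)
Fixpoint alternating a b p0 n k q : Prop :=
  if n is n'.+1 then
    exists2 p, alternating a b p0 n' (~~ k) p & coloured a b k p q
  else coloured a b k p0 q.

Lemma connected_alternating a b p q :
  connected_in a b p q -> p = q \/ exists n k, alternating a b p n k q.
Proof.
move/clos_rt_rtn1_iff; elim=> [|q' r /colouredP[k q'r] _]; first by left.
case=> [->|[n [k' pq']]]; first by right; exists 0%N, k.
have [ekk'|/negP nkk'] := boolP (k == k'); last first.
  right; exists n.+1, k, q' => //.
  by move: nkk' pq'; case: (k); case: (k').
move/eqP: ekk' pq' => <-; case: n => [|n] /=.
  by move=> /coloured_sym pq'; left; exact: coloured_fun pq' q'r.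
move=> [s ps /coloured_sym sq']; right; exists n, (~~ k).
by have <- := coloured_fun sq' q'r.
Qed.

Lemma alternating_fun a b u n k k' q q' :
  alternating a b (outer u) n k q -> alternating a b (outer u) n k' q' ->
  k = k' /\ q = q'.
Proof.
elim: n k k' q q' => [|n IHn] k k' q q' /=.
  move=> uq uq'; have ekk' := coloured_outer uq uq'; subst k'.
  by split=> //; exact: coloured_fun uq uq'.
move=> [p up pq] [p' up' pq']; have [/negb_inj ekk' epp'] := IHn _ _ _ _ up up'.
by subst k' p'; split=> //; exact: coloured_fun pq pq'.
Qed.

Lemma alternating_outer a b u v n m k k' q :
  alternating a b (outer u) n k (outer v) ->
  ~ alternating a b (outer u) (n + m).+1 k' q.
Proof.
move=> uv; elim: m k' q => [|m IHm] k' q; last first.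
  by rewrite addnS => -[p up _]; exact: IHm up.
rewrite addn0 => -[p up pq]; have [ek ep] := alternating_fun uv up.
subst k p; case: n uv {up} => [|n] /= => [|[p _]] /coloured_sym vp.
  by have := coloured_outer vp pq; case: (k').
by have := coloured_outer vp pq; case: (k').
Qed.

Lemma mul_adj_degree_le1 a b u v w :
  mul_adj a b u v -> mul_adj a b u w -> v = w.
Proof.
move=> [uv /connected_alternating[/outer_inj//|[n [k uvn]]]].
move=> [uw /connected_alternating[/outer_inj//|[m [k' uwm]]]].
have [nm|mn|enm] := ltngtP n m.
- by move: uwm; rewrite -(subnKC nm) addSn => /(alternating_outer uvn).
- by move: uvn; rewrite -(subnKC mn) addSn => /(alternating_outer uwm).
- by subst m; have [_ /outer_inj] := alternating_fun uvn uwm.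
Qed.

Definition mul_brauer a b : brauer_graph X :=
  @BrauerGraph X (mul_adj a b) (@mul_adj_irrefl a b) (@mul_adj_sym a b)
    (@mul_adj_degree_le1 a b).

Definition one_adj (u v : X + X) : Prop :=
  match u, v with
  | inl x, inr y | inr x, inl y => x = y
  | _, _ => False
  end.

Lemma one_adj_irrefl u : ~ one_adj u u.
Proof. by case: u => x []. Qed.

Lemma one_adj_sym u v : one_adj u v -> one_adj v u.
Proof. by case: u v => [x|x] [y|y] //= ->. Qed.

Lemma one_adj_degree_le1 u v w : one_adj u v -> one_adj u w -> v = w.
Proof. by case: u v w => [x|x] [y|y] [z|z] //= <- <-. Qed.

Definition one_brauer : brauer_graph X :=
  BrauerGraph one_adj_irrefl one_adj_sym one_adj_degree_le1.

Lemma adj_neq a u v : a u v -> u <> v.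
Proof. by move=> uv euv; move: uv; rewrite euv; exact: adj_irrefl. Qed.

Lemma mul1_brauer : left_id one_brauer mul_brauer.
Proof.
move=> a; apply: brauer_graphP => u v.
pose pr (p : pvertex X) : X + X :=
  match p with Upper x | Middle x => inl x | Lower x => inr x end.
have pro w : pr (outer w) = w by case: w.
have prw w : pr (wedge w) = w by case: w.
have ow w : connected_in one_brauer a (outer w) (wedge w).
  case: w => x /=; last exact: rt_refl.
  by apply: rt_step; exact: (@product_vee one_brauer a (inl x) (inr x)).
split=> [[uv] /clos_rt_rtn1_iff uva|uv]; last first.
  split; first exact: adj_neq uv.
  apply: rt_trans (ow u) _; apply: rt_trans (connected_in_sym (ow v)).
  by apply: rt_step; exact: product_wedge.
suff H q : clos_refl_trans_n1 _ (product_graph one_brauer a) (outer u) q ->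
    u = pr q \/ a u (pr q).
  by have [|] := H _ uva; rewrite pro.
elim=> [|p r pr' _ IH]; first by rewrite pro; left.
case: pr' IH => [[x|x] [y|y] //= ->|x y xy] //; rewrite !prw => -[ux|ux].
  by right; rewrite ux.
by left; exact: adj_degree_le1 (adj_sym ux) xy.
Qed.

Lemma mulr1_brauer : right_id one_brauer mul_brauer.
Proof.
move=> a; apply: brauer_graphP => u v.
pose pr (p : pvertex X) : X + X :=
  match p with Upper x => inl x | Middle x | Lower x => inr x end.
have pro w : pr (outer w) = w by case: w.
have prv w : pr (vee w) = w by case: w.
have ov w : connected_in a one_brauer (outer w) (vee w).
  case: w => x /=; first exact: rt_refl.
  by apply: rt_step; exact: (@product_wedge a one_brauer (inr x) (inl x)).
split=> [[uv] /clos_rt_rtn1_iff uva|uv]; last first.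
  split; first exact: adj_neq uv.
  apply: rt_trans (ov u) _; apply: rt_trans (connected_in_sym (ov v)).
  by apply: rt_step; exact: product_vee.
suff H q : clos_refl_trans_n1 _ (product_graph a one_brauer) (outer u) q ->
    u = pr q \/ a u (pr q).
  by have [|] := H _ uva; rewrite pro.
elim=> [|p r pr' _ IH]; first by rewrite pro; left.
case: pr' IH => [x y xy|[x|x] [y|y] //= ->] //; rewrite !prv => -[ux|ux].
  by right; rewrite ux.
by left; exact: adj_degree_le1 (adj_sym ux) xy.
Qed.

(* Associativity: both bracketings are read off the graph stacking a, b, c. *)
Inductive svertex := S0 of X | S1 of X | S2 of X | S3 of X.

Definition lay01 (u : X + X) := match u with inl x => S0 x | inr x => S1 x end.
Definition lay12 (u : X + X) := match u with inl x => S1 x | inr x => S2 x end.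
Definition lay23 (u : X + X) := match u with inl x => S2 x | inr x => S3 x end.
Definition lay03 (u : X + X) := match u with inl x => S0 x | inr x => S3 x end.

Inductive stack a b c : svertex -> svertex -> Prop :=
| stack01 u v of a u v : stack a b c (lay01 u) (lay01 v)
| stack12 u v of b u v : stack a b c (lay12 u) (lay12 v)
| stack23 u v of c u v : stack a b c (lay23 u) (lay23 v).

Lemma stack_mull a b c u v :
  connected_in (mul_brauer a b) c (outer u) (outer v) <->
  clos_refl_trans _ (stack a b c) (lay03 u) (lay03 v).
Proof.
pose e p := match p with Upper x => S0 x | Middle x => S2 x | Lower x => S3 x end.
pose f p := match p with Upper x => S0 x | Middle x => S1 x | Lower x => S2 x end.
have eo w : e (outer w) = lay03 w by case: w.
have ew w : e (wedge w) = lay23 w by case: w.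
have fv w : f (vee w) = lay01 w by case: w.
have fw w : f (wedge w) = lay12 w by case: w.
have fo w : f (outer w) = e (vee w) by case: w.
have fconn p q : connected_in a b p q ->
    clos_refl_trans _ (stack a b c) (f p) (f q).
  elim=> [_ _ [{}u {}v uv|{}u {}v uv]|{}p|{}p {}q r _ pq _ qr].
  - by rewrite !fv; exact/rt_step/stack01.
  - by rewrite !fw; exact/rt_step/stack12.
  - exact: rt_refl.
  - exact: rt_trans pq qr.
split=> [|].
  rewrite -!eo; elim=> [_ _ [{}u {}v [_ uv]|{}u {}v uv]|p|p q r _ pq _ qr].
  - by rewrite -!fo; exact: fconn.
  - by rewrite !ew; exact/rt_step/stack23.
  - exact: rt_refl.
  - exact: rt_trans pq qr.
set C := connected_in _ c.
have Cab w w' : connected_in a b (outer w) (outer w') -> C (vee w) (vee w').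
  have [-> _|ww' conn] := EM (w = w'); first exact: rt_refl.
  by apply: rt_step; exact: product_vee.
pose inv s := match s with
  | S0 x => C (outer u) (Upper x)
  | S1 x => exists w, C (outer u) (vee w) /\ connected_in a b (outer w) (Middle x)
  | S2 x => C (outer u) (Middle x)
  | S3 x => C (outer u) (Lower x) end.
have inve p : inv (e p) <-> C (outer u) p by case: p.
have invf p : inv (f p) <->
    exists w, C (outer u) (vee w) /\ connected_in a b (outer w) p.
  case: p => x //=; split.
  - by exists (inl x); split=> //; exact: rt_refl.
  - move=> [w [uw /(Cab w (inl x))]]; exact: rt_trans.
  - by exists (inr x); split=> //; exact: rt_refl.
  - move=> [w [uw /(Cab w (inr x))]]; exact: rt_trans.
rewrite -[in X in _ -> X](inve (outer v)) eo => /clos_rt_rtn1_iff.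
elim=> [|s t st _]; first by rewrite -eo inve; exact: rt_refl.
case: st => u' v' uv'.
- rewrite -!fv !invf => -[w [uw wu]]; exists w; split=> //.
  by apply: rt_trans wu _; apply: rt_step; exact: product_vee.
- rewrite -!fw !invf => -[w [uw wu]]; exists w; split=> //.
  by apply: rt_trans wu _; apply: rt_step; exact: product_wedge.
- rewrite -!ew !inve => uu'; apply: rt_trans uu' _; apply: rt_step.
  exact: product_wedge.
Qed.

Lemma stack_mulr a b c u v :
  connected_in a (mul_brauer b c) (outer u) (outer v) <->
  clos_refl_trans _ (stack a b c) (lay03 u) (lay03 v).
Proof.
pose e p := match p with Upper x => S0 x | Middle x => S1 x | Lower x => S3 x end.
pose f p := match p with Upper x => S1 x | Middle x => S2 x | Lower x => S3 x end.
have eo w : e (outer w) = lay03 w by case: w.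
have ev w : e (vee w) = lay01 w by case: w.
have fv w : f (vee w) = lay12 w by case: w.
have fw w : f (wedge w) = lay23 w by case: w.
have fo w : f (outer w) = e (wedge w) by case: w.
have fconn p q : connected_in b c p q ->
    clos_refl_trans _ (stack a b c) (f p) (f q).
  elim=> [_ _ [{}u {}v uv|{}u {}v uv]|{}p|{}p {}q r _ pq _ qr].
  - by rewrite !fv; exact/rt_step/stack12.
  - by rewrite !fw; exact/rt_step/stack23.
  - exact: rt_refl.
  - exact: rt_trans pq qr.
split=> [|].
  rewrite -!eo; elim=> [_ _ [{}u {}v uv|{}u {}v [_ uv]]|p|p q r _ pq _ qr].
  - by rewrite !ev; exact/rt_step/stack01.
  - by rewrite -!fo; exact: fconn.
  - exact: rt_refl.
  - exact: rt_trans pq qr.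
set C := connected_in a _.
have Cbc w w' : connected_in b c (outer w) (outer w') -> C (wedge w) (wedge w').
  have [-> _|ww' conn] := EM (w = w'); first exact: rt_refl.
  by apply: rt_step; exact: product_wedge.
pose inv s := match s with
  | S0 x => C (outer u) (Upper x)
  | S1 x => C (outer u) (Middle x)
  | S2 x => exists w, C (outer u) (wedge w) /\ connected_in b c (outer w) (Middle x)
  | S3 x => C (outer u) (Lower x) end.
have inve p : inv (e p) <-> C (outer u) p by case: p.
have invf p : inv (f p) <->
    exists w, C (outer u) (wedge w) /\ connected_in b c (outer w) p.
  case: p => x //=; split.
  - by exists (inl x); split=> //; exact: rt_refl.
  - move=> [w [uw /(Cbc w (inl x))]]; exact: rt_trans.
  - by exists (inr x); split=> //; exact: rt_refl.
  - move=> [w [uw /(Cbc w (inr x))]]; exact: rt_trans.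
rewrite -[in X in _ -> X](inve (outer v)) eo => /clos_rt_rtn1_iff.
elim=> [|s t st _]; first by rewrite -eo inve; exact: rt_refl.
case: st => u' v' uv'.
- rewrite -!ev !inve => uu'; apply: rt_trans uu' _; apply: rt_step.
  exact: product_vee.
- rewrite -!fv !invf => -[w [uw wu]]; exists w; split=> //.
  by apply: rt_trans wu _; apply: rt_step; exact: product_vee.
- rewrite -!fw !invf => -[w [uw wu]]; exists w; split=> //.
  by apply: rt_trans wu _; apply: rt_step; exact: product_wedge.
Qed.

Lemma mulA_brauer : associative mul_brauer.
Proof.
move=> a b c; apply: brauer_graphP => u v.
split=> -[uv conn]; split=> //.
  by apply/stack_mull/stack_mulr.
by apply/stack_mulr/stack_mull.
Qed.

End Product.

HB.instance Definition _ X := isMonoid.Build (brauer_graph X)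
  (@mulA_brauer X) (@mul1_brauer X) (@mulr1_brauer X).

Section Monoids.
Variable M : monoidType.
Local Open Scope group_scope.

Definition left_units : set M := [set x | exists a, a * x = 1].

Definition two_sided_units : set M :=
  [set x | (exists a, a * x = 1) /\ (exists b, x * b = 1)].

Definition subsemigroup (S : set M) : Prop :=
  forall x y, S x -> S y -> S (x * y).

Definition generated (U : set M) : set M := smallest subsemigroup U.

(* rank(S : A) = |K|: the minimum over U is attained and equal to |K|. *)
Definition relative_rank_is (S A : set M) (T : Type) (K : set T) : Prop :=
  (exists U, [/\ U `<=` S, S = generated (A `|` U) & U #= K]) /\
  (forall U, U `<=` S -> S = generated (A `|` U) -> K #<= U).

End Monoids.

Arguments left_units M : clear implicits.
Arguments two_sided_units M : clear implicits.

Section Cardinals.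
Variable X : Type.

(* A cardinal mu <= |X| is encoded as the set of all subsets of X of
   cardinality mu. *)
Definition card_in {T : Type} (A : set T) : set (set X) :=
  [set B : set X | B #= A].

(* The cardinals mu with aleph_0 <= mu <= |X|: rho is the cardinality of this
   set. *)
Definition infinite_cards : set (set (set X)) :=
  [set mu | exists2 A : set X, [set: nat] #<= A & mu = card_in A].

Definition one_or_infinite_cards : set (set (set X)) :=
  [set card_in [set: unit]] `|` infinite_cards.

(* A set of cardinality 2 + 2 rho. *)
Definition two_plus_two_rho : set (bool + bool * set (set X)) :=
  [set i | match i with inl _ => True | inr (_, mu) => infinite_cards mu end].

Definition upper_hooks (a : brauer_graph X) : set (set X) :=
  [set e | exists x y, a (inl x) (inl y) /\ e = [set x; y]].

Definition upper_singletons (a : brauer_graph X) : set X :=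
  [set x | forall v, ~ a (inl x) v].

(* h(a) and s(a); both are at most |X| (see [upper_hooks_le]), hence faithfully
   encoded by [card_in] (see [card_inP]). *)
Definition hooks (a : brauer_graph X) : set (set X) := card_in (upper_hooks a).

Definition singletons (a : brauer_graph X) : set (set X) :=
  card_in (upper_singletons a).

End Cardinals.

Arguments card_in X {T} A.
Arguments infinite_cards X : clear implicits.
Arguments one_or_infinite_cards X : clear implicits.
Arguments two_plus_two_rho X : clear implicits.

Lemma card_inP X T U (A : set T) (B : set U) : A #<= [set: X] ->
  card_in X A = card_in X B <-> A #= B.
Proof.
move=> AX; split=> [eAB|AB]; last first.
  by apply/seteqP; split=> C /=; rewrite /card_in /= (card_eqr AB).
have [C CA] : exists C : set X, C #= A.
  elim/Ppointed: X => X in AX {eAB} *; last first.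
    by have /pcard_leTP[f] := AX; exists (f @` A); exact: card_image.
  by exists set0; move: AX; rewrite empty_eq0 => /card_le0P ->.
by rewrite -(card_eql CA); have : card_in X B C by rewrite -eAB.
Qed.

Lemma upper_hooks_le X (a : brauer_graph X) : upper_hooks a #<= [set: X].
Proof.
have /choice[f fP] e : exists x : option X, upper_hooks a e ->
    exists z y, [/\ x = Some z, a (inl z) (inl y) & e = [set z; y]].
  have [[x [y [xy ->]]]|nx] := EM (upper_hooks a e); last by exists None.
  by exists (Some x) => _; exists x, y.
have injf : {in upper_hooks a &, injective f}.
  move=> e e' /set_mem/fP[z [y [ez zy ee]]] /set_mem/fP[z' [y' [ez' zy' ee']]].
  rewrite ez ez' ee ee' => -[ezz']; move: zy'; rewrite -ezz'.
  by move=> /(adj_degree_le1 zy)[->].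
rewrite -(card_le_eql (inj_card_eq injf)) -(card_le_eqr (@card_some _ [set: X])).
by apply: subset_card_le => _ [e /fP[z [y [-> _ _]]] <-]; exists z.
Qed.

(* Main.v *)
Require Import Defs.
From Stdlib Require Import Relation_Operators Operators_Properties.
From mathcomp Require Import all_boot finmap.
From mathcomp Require Import boolp classical_sets functions cardinality.

(** Let a be a left unit, say b a = 1. The path from a lower vertex y' up to y
    in the product graph of b and a has to leave y' by an edge of a, and that
    edge goes up ([left_unit_lower]). So a is an injection f : X -> X, given by
    the edges {f y, y'}, together with hooks and singletons on the complement of
    its image; conversely every such graph is a left unit
    ([presents_left_unit]). Multiplying by another left unit on the right
    composes the injections and moves the hooks and singletons of the second
    factor along f. Consequently h and s are additive on left units
    ([count_mul], [count_mul_split]). They vanish on units ([unit_count]), and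
    two left units with the same h and s differ by a permutation of X, hence by
    a unit on the left ([count_unit_orbit]). All pairs of cardinals up to |X|
    occur ([left_unit_exists]).

    The question is thereby reduced to the additive monoid of pairs (h, s) of
    cardinals up to |X|. Such a pair is the sum of (h, 0) and (0, s), a finite
    cardinal is a sum of ones, and 1 and the infinite cardinals cannot be
    written as a sum of two cardinals both different from them, because the sum
    of two cardinals with infinite sum is the larger one
    ([card_sum_infinite]). So a set U of left units generates everything
    together with the units if and only if it contains, for every mu that is 1
    or infinite, an element with (h, s) = (mu, 0) and one with (h, s) = (0, mu)
    ([generates_left_units], [generating_has_profiles]). There are 2 + 2 rho
    such requirements, and one element meets at most one of them
    ([profile_uniq]), which gives the relative rank. If rho is finite, a
    generating set with 2 + 2 rho elements has nothing besides one element for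
    each requirement, which gives the second part. *)

Set Implicit Arguments.
Unset Strict Implicit.
Unset Printing Implicit Defensive.

Local Open Scope classical_set_scope.
Local Open Scope card_scope.

(** * Cardinals of sums *)

Lemma card_leTP T U :
  [set: T] #<= [set: U] <-> exists f : T -> U, injective f.
Proof.
split=> [/card_leP[f]|[f injf]].
  exists (fun x => val (f (SigSub (in_setT x)))) => x y /val_inj.
  by move=> /(@inj _ _ _ f); rewrite !in_setT => /(_ isT isT)[].
have := @inj_card_eq _ _ [set: T] f (in2W injf).
by move=> /card_le_eql <-; exact: card_leT.
Qed.

Lemma card_eqTP T U :
  [set: T] #= [set: U] <-> exists f : T -> U, bijective f.
Proof.
split=> [/card_bijP[f [g fK gK]]|[f [g fK gK]]]; last first.
  rewrite card_eq_le; apply/andP.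
  by split; apply/card_leTP; [exists f | exists g]; exact: can_inj.
exists (fun x => val (f (SigSub (in_setT x)))).
exists (fun x => val (g (SigSub (in_setT x)))) => x.
- set y := f _; rewrite (_ : SigSub _ = y) ?fK //; exact: val_inj.
- set y := g _; rewrite (_ : SigSub _ = y) ?gK //; exact: val_inj.
Qed.

(** A maximal partial injection exhausts one of the two sets, for otherwise a
    pair of fresh elements could be added to it. *)
Lemma card_le_total T U (A : set T) (B : set U) : A #<= B \/ B #<= A.
Proof.
rewrite -(card_le_eql (card_setT A)) -(card_le_eqr (card_setT A)).
rewrite -(card_le_eql (card_setT B)) -(card_le_eqr (card_setT B)).
move: (set_type A) (set_type B) => {A B}T' U'.
pose P (F : set (T' * U')) := forall p q, F p -> F q -> p.1 = q.1 <-> p.2 = q.2.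
have [F FP tot|F [PF maxF]] := @Zorn_bigcup (T' * U')%type P.
  move=> p q [R FR Rp] [S FS Sq].
  by have [RS|SR] := tot R S FR FS; [apply: (FP S)|apply: (FP R)] => //;
    [exact: RS|exact: SR].
have [domF|/existsNP[x nx]] := EM (forall x, exists y, F (x, y)).
  have /choice[f fF] := domF; left; apply/card_leTP; exists f => x y exy.
  by apply/(PF _ _ (fF x) (fF y)).
have [codF|/existsNP[y ny]] := EM (forall y, exists x, F (x, y)).
  have /choice[f fF] := codF; right; apply/card_leTP; exists f => u v euv.
  by apply/(PF _ _ (fF u) (fF v)).
exfalso; apply: (maxF (F `|` [set (x, y)])).
  split=> [p|/(_ (x, y))]; first by left.
  by move=> /(_ (or_intror erefl)) Fxy; apply: nx; exists y.
have new p : F p -> x <> p.1 /\ y <> p.2.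
  case: p => u v Fuv; split=> [exu|eyv].
  - by apply: nx; exists v; rewrite exu.
  - by apply: ny; exists u; rewrite eyv.
move=> p q [Fp|->] [Fq|->]; first exact: PF.
- by have [xp yp] := new _ Fp; split=> /esym.
- by have [xq yq] := new _ Fq; split.
- by [].
Qed.

(** A maximal family [E] of pairwise disjoint injective sequences misses only
    finitely many points, since an infinite remainder would contain one more
    sequence. So [T] is [E * nat] up to a finite set, and the extra factor
    [nat] is absorbed by the one already there. *)
Lemma card_mul_nat {T : Type} :
  infinite_set [set: T] -> [set: T * nat] #<= [set: T].
Proof.
move=> Tinf.
have [E [Einj trivE maxE]] := @ex_maximal_disjoint_subcollection _ _
  (fun f : nat -> T => range f) [set f | injective f].
pose D := ~` \bigcup_(f in E) range f.
have Dfin : finite_set D.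
  apply: contrapT => /infiniteP; rewrite -(card_le_eqr (card_setT D)).
  move=> /card_leTP[f injf]; pose g n : T := val (f n).
  have gD n : D (g n) by have /set_mem := valP (f n).
  have nEg : ~ E g by move=> Eg; apply: (gD 0%N); exists g => //; exists 0%N.
  apply: (maxE (E `|` [set g])).
  - by split=> [h|]; [left|move=> /(_ g (or_intror erefl))].
  - by move=> h [/Einj//|->] m n /val_inj/injf.
  - have sep h : E h -> ~ (range h `&` range g !=set0).
      move=> Eh [_ [[m _ <-] [n _ egh]]]; apply: (gD n).
      by exists h => //; exists m.
    move=> h k [Eh|->] [Ek|->] //; first exact: trivE.
    + by move=> /(sep _ Eh).
    + by rewrite setIC => /(sep _ Ek).
have [f0 Ef0] : exists f0, E f0.
  apply: contrapT => /forallNP E0; apply: Tinf; apply: sub_finite_set Dfin.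
  by move=> x _ [f /E0].
have /(card_le_trans _)-> // : [set: E * nat] #<= [set: T].
  apply/card_leTP; exists (fun p => val p.1 p.2).
  move=> [[f Ef] m] [[g Eg] n] /= efg.
  move/set_mem: (Ef) => Ef'; move/set_mem: (Eg) => Eg'.
  have efg' : f = g.
    by apply: trivE => //; exists (f m); split; [exists m|exists n].
  subst g; rewrite (Einj _ Ef' _ _ efg); congr (_, _); exact: val_inj.
(* The row added for the leftover points is interleaved with that of [f0]. *)
have /(card_le_trans _)-> // : [set: option E * nat] #<= [set: E * nat].
  pose h (p : option E * nat) := match p with
    | (None, n) => (SigSub (mem_set Ef0) : E, n.*2)
    | (Some f, n) => (f, n.*2.+1) end.
  apply/card_leTP; exists h => -[[f|] m] [[g|] n] /= [].
  - by move=> -> /double_inj ->.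
  - by move=> _ /(congr1 odd); rewrite /= !odd_double.
  - by move=> _ /(congr1 odd); rewrite /= !odd_double.
  - by move=> /double_inj ->.
have : [set: T] #<= [set: option E * nat].
  have : countable D by exact: finite_set_countable.
  rewrite /countable -(card_le_eql (card_setT D)) => /card_leTP[d injd].
  have /choice[c cP] x : exists p : option E * nat, match p with
      | (Some f, n) => x = val f n
      | (None, n) => exists2 Dx : x \in D, n = d (SigSub Dx) & True end.
    have [Dx|/contrapT[f Ef [n _ <-]]] := EM (D x).
      by exists (None, d (SigSub (mem_set Dx))); exists (mem_set Dx).
    by exists (Some (SigSub (mem_set Ef)), n).
  apply/card_leTP; exists c => x y exy; move: (cP x) (cP y); rewrite exy.
  case: (c y) => -[f|] n; first by move=> -> ->.
  by move=> [Dx -> _] [Dy /injd[]].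
move=> /card_leTP[j injj].
have [pair injpair] : exists p : nat * nat -> nat, injective p.
  by apply/card_leTP; rewrite (card_le_eql card_nat2).
apply/card_leTP; exists (fun p => ((j p.1).1, pair ((j p.1).2, p.2))).
move=> [x m] [y n] /= [e1 /injpair[e2 ->]]; congr (_, _); apply: injj.
by rewrite [LHS]surjective_pairing e1 e2 -surjective_pairing.
Qed.

(** The larger of the two summands, multiplied by [nat], bounds the sum. With
    [card_sum_unit], this is the reason why 1 and the infinite cardinals are
    needed as generators: they are not sums of two smaller cardinals. *)
Lemma card_sum_infinite A B T : infinite_set [set: T] ->
  [set: A + B] #= [set: T] -> [set: A] #= [set: T] \/ [set: B] #= [set: T].
Proof.
move=> Tinf ABT.
wlog AB : A B ABT / [set: A] #<= [set: B] => [wl|].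
  have [|BA] := card_le_total [set: A] [set: B]; first exact: wl.
  apply/or_comm/wl => //.
  apply: card_eq_trans ABT; apply/card_eqTP.
  pose sw U V (s : U + V) := match s with inl u => inr u | inr v => inl v end.
  by exists (sw _ _), (sw _ _) => -[].
right; rewrite card_eq_le; apply/andP; split.
  by rewrite -(card_le_eqr ABT); apply/card_leTP; exists inr => x y [].
rewrite -(card_le_eql ABT).
have ABn : [set: A + B] #<= [set: B * nat].
  have /card_leTP[f injf] := AB; apply/card_leTP.
  exists (fun s => match s with inl a => (f a, 0%N) | inr b => (b, 1%N) end).
  by move=> [a|b] [a'|b'] //= [] => [/injf|] ->.
apply: (card_le_trans ABn); apply: card_mul_nat => Bfin.
apply: Tinf; rewrite -(eq_finite_set ABT).
have -> : [set: A + B] = [set inl a | a in setT] `|` [set inr b | b in setT].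
  by apply/seteqP; split=> // -[a|b] _; [left; exists a|right; exists b].
rewrite finite_setU; split; apply: finite_image => //.
exact: card_le_finite AB Bfin.
Qed.

Lemma card_sum_eq A A' B B' : [set: A] #= [set: A'] -> [set: B] #= [set: B'] ->
  [set: A + B] #= [set: A' + B'].
Proof.
move=> /card_eqTP[f [f' fK f'K]] /card_eqTP[g [g' gK g'K]]; apply/card_eqTP.
pose sum C D C' D' (u : C -> C') (v : D -> D') (s : C + D) :=
  match s with inl x => inl (u x) | inr y => inr (v y) end.
by exists (sum _ _ _ _ f g), (sum _ _ _ _ f' g') => -[x|y] /=;
  rewrite ?fK ?gK ?f'K ?g'K.
Qed.

Lemma card_void T : [set: T] #= [set: void] <-> (T -> False).
Proof.
split=> [/card_eqTP[f _] x|T0]; first by case: (f x).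
apply/card_eqTP; exists (fun x => match T0 x with end), (of_void T) => [x|[]].
by case: (T0 x).
Qed.

Lemma card_sum_unit A B : [set: A + B] #= [set: unit] ->
  [set: A] #= [set: unit] \/ [set: B] #= [set: unit].
Proof.
move=> /card_eqTP[f [g fK gK]].
have uniqT x : x = g tt by rewrite -(fK x); case: (f x).
case: (g tt) uniqT => z uniqT; [left|right]; apply/card_eqTP.
- exists (fun _ => tt), (fun _ => z) => [x|[]] //.
  by have [] := uniqT (inl x).
- exists (fun _ => tt), (fun _ => z) => [x|[]] //.
  by have [] := uniqT (inr x).
Qed.

Lemma card_sum_void A B : [set: B] #= [set: void] -> [set: A + B] #= [set: A].
Proof.
move=> /card_void B0; apply/card_eqTP.
exists (fun s => match s with inl x => x | inr y => match B0 y with end end).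
exists inl => //.
by case=> // y; case: (B0 y).
Qed.

Lemma finite_subset_card_eq (T : choiceType) (A B : set T) :
  A `<=` B -> finite_set B -> A #= B -> A = B.
Proof.
move=> AB Bfin eAB; have Afin := sub_finite_set AB Bfin.
have /(fcard_eq Afin Bfin) cardAB := eAB.
suff eAB' : fset_set A = fset_set B by rewrite -(fset_setK Afin) eAB' fset_setK.
apply/eqP; rewrite eqEfcard cardAB leqnn andbT.
by rewrite fset_set_sub in AB.
Qed.

(** * The structure of left units *)

Lemma inj_surj_bij T U (f : T -> U) :
  injective f -> (forall y, exists x, f x = y) -> bijective f.
Proof.
move=> injf /choice[g gK]; exists g => // x.
by apply: injf; rewrite gK.
Qed.

Section Presentations.
Variable X : Type.
Implicit Types (K : bool -> Type) (a b : brauer_graph X).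

(** The shape of the upper row of a left unit. Every lower vertex y' of a left
    unit is joined to some upper vertex, so the upper vertices are of three
    kinds: the other ends of these edges, indexed by [X]; the two ends of every
    upper hook, the hooks being indexed by [K true]; and the upper singletons,
    indexed by [K false]. *)
Definition slots K : Type := X + (K true * bool + K false).

Definition through {K} (y : X) : slots K := inl y.
Definition hook {K} (k : K true) (s : bool) : slots K := inr (inl (k, s)).
Definition single {K} (l : K false) : slots K := inr (inr l).

(** A left unit is described by a bijection from its slots to [X], which turns
    products into composition ([presents_mul]) and makes isomorphic changes of
    the index types harmless ([presents_reindex]). *)
Definition presents K (e : slots K -> X) a :=
  [/\ bijective e,
      forall y, a (inl (e (through y))) (inr y),
      forall k s, a (inl (e (hook k s))) (inl (e (hook k (~~ s)))) &
      forall l v, ~ a (inl (e (single l))) v].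

Lemma presents_uniq K (e : slots K -> X) a b :
  presents e a -> presents e b -> a = b.
Proof.
have sub a' b' u v : presents e a' -> presents e b' -> a' u v -> b' u v.
  move=> [[g _ gK] at_ ah asg] [_ bt bh _].
  case: u => [x|y]; last first.
    move/(adj_degree_le1 (adj_sym (at_ y))) <-; exact/adj_sym/bt.
  rewrite -(gK x); case: (g x) => [y|[[k s]|l]].
  - by move/(adj_degree_le1 (at_ y)) <-; exact: bt.
  - by move/(adj_degree_le1 (ah k s)) <-; exact: bh.
  - by move/asg.
by move=> ea eb; apply: brauer_graphP => u v; split; exact: sub.
Qed.

Lemma presents_exists K (e : slots K -> X) :
  bijective e -> exists a, presents e a.
Proof.
move=> bije; have [g eK gK] := bije.
pose mate (u : X + X) : option (X + X) := match u with
  | inr y => Some (inl (e (through y)))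
  | inl x => match g x with
    | inl y => Some (inr y)
    | inr (inl (k, s)) => Some (inl (e (hook k (~~ s))))
    | inr (inr _) => None end end.
have irr u : mate u <> Some u.
  case: u => [x|x] //=; case gx: (g x) => [y|[[k s]|l]] //= [ex].
  by move: gx; rewrite -ex eK => -[]; case: (s).
have sym u v : mate u = Some v -> mate v = Some u.
  case: u => [x|x] /=; last by move=> [<-] /=; rewrite eK.
  case gx: (g x) => [y|[[k s]|l]] //= [<-] /=.
    by rewrite -(gK x) gx.
  by rewrite eK /= negbK /hook -gx gK.
have deg u v w : mate u = Some v -> mate u = Some w -> v = w by move=> -> [].
exists (BrauerGraph irr sym deg); split=> //= [y|k s|l v]; by rewrite eK.
Qed.

Local Open Scope group_scope.

Definition no_block (c : bool) : Type := void.

(** A presentation without hooks or singletons: the graph of a permutation. *)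
Definition perm_slots (f : X -> X) (i : slots no_block) : X :=
  match i with
  | inl y => f y
  | inr (inl (k, _)) => match k with end
  | inr (inr l) => match l with end
  end.

Lemma perm_slots_bij f : bijective f -> bijective (perm_slots f).
Proof.
move=> [g fK gK]; exists (through \o g) => [|x] /=; last by rewrite gK.
by case=> [y|[[[]]|[]]] /=; rewrite fK.
Qed.

Lemma presents_perm f a : bijective f ->
  (forall y, a (inl (f y)) (inr y)) -> presents (perm_slots f) a.
Proof.
move=> bijf fa; split=> [|y|[]|[]]; [exact: perm_slots_bij|exact: fa].
Qed.

Lemma presents_one : presents (perm_slots id) (1 : brauer_graph X).
Proof. by apply: presents_perm => //; exists id. Qed.

Lemma presents_id_one a : presents (perm_slots id) a -> a = 1.
Proof. by move/presents_uniq; apply; exact: presents_one. Qed.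

Lemma mul_edge a b u v : u <> v ->
  connected_in a b (outer u) (outer v) -> (a * b)%g u v.
Proof. by []. Qed.

Lemma vee_step a b u v : a u v -> connected_in a b (vee u) (vee v).
Proof. by move=> uv; apply: rt_step; exact: product_vee. Qed.

Lemma wedge_step a b u v : b u v -> connected_in a b (wedge u) (wedge v).
Proof. by move=> uv; apply: rt_step; exact: product_wedge. Qed.

Lemma step_upper a b x q : product_graph a b (Upper x) q ->
  exists2 v, a (inl x) v & q = vee v.
Proof.
move: {-1}(Upper x) (erefl (Upper x)) => p ep pq.
by case: pq ep => -[z|z] v zv //= [->]; exists v.
Qed.

Lemma step_lower a b x q : product_graph a b (Lower x) q ->
  exists2 v, b (inr x) v & q = wedge v.
Proof.
move: {-1}(Lower x) (erefl (Lower x)) => p ep pq.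
by case: pq ep => -[z|z] v zv //= [->]; exists v.
Qed.

Lemma step_middle a b x q : product_graph a b (Middle x) q ->
  (exists2 v, a (inr x) v & q = vee v) \/
  (exists2 v, b (inl x) v & q = wedge v).
Proof.
move: {-1}(Middle x) (erefl (Middle x)) => p ep pq.
by case: pq ep => -[z|z] v zv //= [->]; [left|right]; exists v.
Qed.

Definition swap (u : X + X) := match u with inl x => inr x | inr x => inl x end.

Lemma flip_exists a :
  exists b : brauer_graph X, forall u v, b u v = a (swap u) (swap v).
Proof.
have irr u : ~ a (swap u) (swap u) by exact: adj_irrefl.
have sym u v : a (swap u) (swap v) -> a (swap v) (swap u) by exact: adj_sym.
have deg u v w : a (swap u) (swap v) -> a (swap u) (swap w) -> v = w.
  move=> uv uw; have := adj_degree_le1 uv uw.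
  by case: v w {uv uw} => [v|v] [w|w] //= [->].
by exists (BrauerGraph irr sym deg).
Qed.

(** The mirror image of [a] is a left inverse: each y' leads up to its upper
    partner and back. *)
Lemma presents_left_unit K (e : slots K -> X) a :
  presents e a -> left_units _ a.
Proof.
move=> [_ at_ _ _]; have [b ba] := flip_exists a; exists b.
apply: presents_id_one; apply: presents_perm => [|y]; first by exists id.
apply: mul_edge => //; apply: (@rt_trans _ _ _ (Middle (e (through y)))).
  by apply: (@vee_step _ _ (inl y) (inr _)); rewrite ba; exact/adj_sym/at_.
exact: (@wedge_step _ _ (inl _) (inr y)).
Qed.

(** If [b * a = 1] then the path from y' up to y must leave y' by an edge of
    [a]. Its other end is not a lower vertex z', because the edge {y', z'} would
    survive in [b * a]. *)
Lemma left_unit_lower a y : left_units _ a -> exists x, a (inl x) (inr y).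
Proof.
move=> [b ba1].
have [_ /connected_in_sym/clos_rt_rt1n_iff] : (b * a)%g (inl y) (inr y).
  by rewrite ba1.
move=> yy; have [q yq] : exists q, product_graph b a (Lower y) q.
  suff step p r : clos_refl_trans_1n _ (product_graph b a) p r -> p <> r ->
    exists q, product_graph b a p q by exact: step yy _.
  by case=> // q s pq _ _; exists q.
have [[x|z] yv _] := step_lower yq; first by exists x; exact: adj_sym.
have : (b * a)%g (inr y) (inr z).
  apply: mul_edge; first exact: adj_neq yv.
  exact: (@wedge_step _ _ (inr y) (inr z)).
by rewrite ba1.
Qed.

Definition block_type a (c : bool) : Type :=
  if c then set_type (upper_hooks a) else set_type (upper_singletons a).

Lemma left_unit_presented a : left_units _ a ->
  exists e : slots (block_type a) -> X, presents e a.
Proof.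
move=> lua; have /choice[f fa] := fun y => @left_unit_lower a y lua.
have /choice[p pP] (E : upper_hooks a) : exists p : X * X,
    a (inl p.1) (inl p.2) /\ val E = [set p.1; p.2].
  by have /set_mem[x [y [xy ->]]] := valP E; exists (x, y).
pose e (i : slots (block_type a)) : X := match i with
  | inl y => f y
  | inr (inl (E, s)) => if s then (p E).1 else (p E).2
  | inr (inr l) => val l end.
have eh E s : a (inl (e (hook E s))) (inl (e (hook E (~~ s)))).
  by have [] := pP E; case: s => //=; move/adj_sym.
have es l v : ~ a (inl (e (single l))) v by have /set_mem := valP l; apply.
have valE (E : upper_hooks a) s : val E = [set e (hook E s); e (hook E (~~ s))].
  by have [_ ->] := pP E; case: s => //=; rewrite setUC.
exists e; split=> //; apply: inj_surj_bij => [|x].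
  case=> [y|[[E s]|l]] [y'|[[E' s']|l']] eij.
  - by move: (fa y); rewrite [f y]eij => /(adj_degree_le1 (fa y'))[->].
  - by move: (fa y); rewrite [f y]eij => /(adj_degree_le1 (eh E' s')).
  - by move: (fa y); rewrite [f y]eij => /(es l').
  - by move: (eh E s); rewrite [e (hook E s)]eij => /(adj_degree_le1 (fa y')).
  - have mate : e (hook E (~~ s)) = e (hook E' (~~ s')).
      move: (eh E s); rewrite [e (hook E s)]eij.
      by move=> /(adj_degree_le1 (eh E' s'))[].
    have EE' : E = E'.
      apply: val_inj; rewrite [val E](valE _ s) [val E'](valE _ s') mate.
      by rewrite [e (hook E s)]eij.
    subst E'; have [->//|ss'] := eqVneq s s'.
    have es' : s' = ~~ s by case: (s) (s') ss' => -[].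
    by move: (eh E s); rewrite -es' -[e (hook E s')]eij => /adj_irrefl.
  - by move: (eh E s); rewrite [e (hook E s)]eij => /(es l').
  - by move: (fa y'); rewrite -[f y']eij => /(es l).
  - by move: (eh E' s'); rewrite -[e (hook E' s')]eij => /(es l).
  - by congr (inr (inr _)); exact: val_inj.
have [[v xv]|/forallNP nx] := EM (exists v, a (inl x) v); last first.
  by exists (single (SigSub (mem_set nx))).
case: v xv => [x'|y] xv; last first.
  exists (through y).
  by have [] := adj_degree_le1 (adj_sym (fa y)) (adj_sym xv).
have hE : upper_hooks a [set x; x'] by exists x, x'.
pose E : upper_hooks a := SigSub (mem_set hE).
have : val E x by left.
rewrite (valE E true) => -[->|->]; first by exists (hook E true).
by exists (hook E false).
Qed.

(** The upper row of [a * b]: the hooks and singletons of [a] stay in place,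
    and those of [b] are carried up along the through edges of [a]. *)
Definition mul_slots K K' (e : slots K -> X) (e' : slots K' -> X)
    (i : slots (fun c => K c + K' c)%type) : X :=
  match i with
  | inl y => e (through (e' (through y)))
  | inr (inl (inl k, s)) => e (hook k s)
  | inr (inl (inr k, s)) => e (through (e' (hook k s)))
  | inr (inr (inl l)) => e (single l)
  | inr (inr (inr l)) => e (through (e' (single l)))
  end.

Lemma mul_slots_bij K K' (e : slots K -> X) (e' : slots K' -> X) :
  bijective e -> bijective e' -> bijective (mul_slots e e').
Proof.
move=> [g eK gK] [g' eK' gK'].
pose h x : slots (fun c => K c + K' c)%type := match g x with
  | inl y => match g' y with
    | inl z => inl z
    | inr (inl (k, s)) => inr (inl (inr k, s))
    | inr (inr l) => inr (inr (inr l))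
    end
  | inr (inl (k, s)) => inr (inl (inl k, s))
  | inr (inr l) => inr (inr (inl l))
  end.
exists h => [[y|[[[k|k] s]|[l|l]]]|x]; rewrite /h /= ?eK /= ?eK' //.
rewrite -{2}(gK x); case: (g x) => [y|[[k s]|l]] //=.
by rewrite -{2}(gK' y); case: (g' y) => [z|[[k s]|l]].
Qed.

(** Every vertex of the middle row is joined to the upper row by an edge of [a],
    so no path of the product graph has more than three edges. *)
Lemma presents_mul K K' (e : slots K -> X) (e' : slots K' -> X) a b :
  presents e a -> presents e' b -> presents (mul_slots e e') (a * b).
Proof.
move=> [bije at_ ah asg] [bije' bt bh bsg].
have bij2 := mul_slots_bij bije bije'.
have up y v : connected_in a b (Middle y) v ->
    connected_in a b (Upper (e (through y))) v.
  by apply: rt_trans; exact: (@vee_step _ _ (inl _) (inr y)).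
split=> // [y|k s|l v].
- apply: mul_edge => //=; apply: up.
  exact: (@wedge_step _ _ (inl _) (inr y)).
- have neq : mul_slots e e' (hook k s) <> mul_slots e e' (hook k (~~ s)).
    by move=> /(bij_inj bij2)[]; case: (s).
  apply: mul_edge => [[/neq]|] //.
  case: k {neq} => k /=; first exact: (@vee_step _ _ (inl _) (inl _)).
  apply: (up _ _); apply: connected_in_sym; apply: (up _ _).
  apply: connected_in_sym.
  exact: (@wedge_step _ _ (inl _) (inl _)).
- (* [inv] is the connected component of a singleton of the product: one
     vertex if it comes from [a], two if it comes from [b]. *)
  move=> [uv /clos_rt_rtn1_iff uv'].
  pose inv p := match l with
    | inl l => p = Upper (e (single l))
    | inr l =>
      p = Upper (e (through (e' (single l)))) \/ p = Middle (e' (single l))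
    end.
  have : inv (outer v).
    elim: uv' => [|p q pq _]; rewrite /inv /=.
      by case: (l) => [l'|l'] //; left.
    case: (l) => [l'|l'].
      by move=> ep; move: pq; rewrite ep => /step_upper[w /asg].
    case=> ep; move: pq; rewrite ep.
      by move=> /step_upper[w /(adj_degree_le1 (at_ _)) <- ->]; right.
    move=> /step_middle[[w aw ->]|[w /bsg//]].
    by rewrite -(adj_degree_le1 (adj_sym (at_ _)) aw); left.
  rewrite /inv; case: l v uv {uv' inv} => l [x|x] //= uv.
  - by case=> ex; apply: uv; rewrite ex.
  - by case=> // -[ex]; apply: uv; rewrite ex.
  - by case.
Qed.

Lemma presents_reindex K K' (e : slots K -> X) (f : forall c, K' c -> K c) a :
  (forall c, bijective (f c)) -> presents e a ->
  presents (fun i => match i with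
    | inl y => e (through y)
    | inr (inl (k, s)) => e (hook (f _ k) s)
    | inr (inr l) => e (single (f _ l)) end) a.
Proof.
move=> bijf [[g eK gK] at_ ah asg].
split=> [|y|k s|l]; [|exact: at_|exact: ah|exact: asg].
have [h fK hK] := bijf true; have [h' fK' hK'] := bijf false.
exists (fun x => match g x with
    | inl y => inl y
    | inr (inl (k, s)) => inr (inl (h k, s))
    | inr (inr l) => inr (inr (h' l)) end) => [[y|[[k s]|l]]|x].
- by rewrite eK.
- by rewrite eK /= fK.
- by rewrite eK /= fK'.
by rewrite -{2}(gK x); case: (g x) => [y|[[k s]|l]] //=; rewrite ?hK ?hK'.
Qed.

(** h and s as one function, so that the symmetric statements about hooks and
    singletons are proved once. *)
Definition block_count a (c : bool) : set (set X) :=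
  if c then hooks a else singletons a.

Lemma countE K (e : slots K -> X) a c :
  presents e a -> block_count a c = card_in X [set: K c].
Proof.
move=> [[g eK gK] at_ ah asg]; rewrite /block_count.
suff ce : if c then upper_hooks a #= [set: K c]
    else upper_singletons a #= [set: K c].
  case: c ce => ce; apply/seteqP; split=> B;
  by rewrite /hooks /singletons /card_in /= (card_eqr ce).
case: c.
  pose p k := [set e (hook k true); e (hook k false)].
  have injp : injective p.
    move=> k k' pkk'; have : p k (e (hook k true)) by left.
    by rewrite pkk' => -[] /(can_inj eK)[].
  rewrite -(card_eqr (inj_card_eq (in2W injp))).
  rewrite (_ : upper_hooks a = p @` setT) //; apply/seteqP.
  split=> [E [x [x' [xx' ->]]]|_ [k _ <-]].
    have := ah; rewrite -(gK x) in xx' *; case: (g x) xx' => [y|[[k s]|l]].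
    - by move=> /(adj_degree_le1 (at_ y)).
    - move=> /(adj_degree_le1 (ah k s))[<-] _; exists k => //.
      by rewrite /p; case: s => //=; rewrite setUC.
    - by move=> /asg.
  exists (e (hook k true)), (e (hook k false)).
  by split=> //; exact: (ah k true).
have inje : injective (e \o single) by move=> l l' /(can_inj eK)[].
rewrite -(card_eqr (inj_card_eq (in2W inje))).
rewrite (_ : upper_singletons a = (e \o single) @` setT) //.
apply/seteqP; split=> [x nx|_ [l _ <-] v]; last exact: asg.
rewrite -(gK x) in nx *; case: (g x) nx => [y|[[k s]|l]].
- by move=> /(_ _ (at_ y)).
- by move=> /(_ _ (ah k s)).
- by exists l.
Qed.

End Presentations.

Arguments through {X K} y.
Arguments hook {X K} k s.
Arguments single {X K} l.

(** * Numbers of hooks and singletons *)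

Section Profiles.
Variable X : Type.
Hypothesis X_infinite : infinite_set [set: X].
Implicit Types (K : bool -> Type) (a b : brauer_graph X).
Local Open Scope group_scope.

Local Notation lunits := (left_units (brauer_graph X)).
Local Notation units := (two_sided_units (brauer_graph X)).

Lemma card_in_eq T U :
  [set: T] #= [set: U] -> card_in X [set: T] = card_in X [set: U].
Proof.
by move=> TU; apply/seteqP; split=> B; rewrite /card_in /= (card_eqr TU).
Qed.

Lemma block_le K (e : slots X K -> X) a c :
  presents e a -> [set: K c] #<= [set: X].
Proof.
move=> [/bij_inj inje _ _ _]; apply/card_leTP; case: c.
- by exists (fun k : K true => e (hook k true)) => k k' /inje[].
- by exists (fun l : K false => e (single l)) => l l' /inje[].
Qed.

Lemma presents_lcomp K (e : slots X K -> X) f a b :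
  presents (perm_slots f) a -> presents e b -> presents (f \o e) (a * b).
Proof.
move=> fa eb; have inr_bij c : bijective (inr : K c -> (no_block c + K c)%type).
  exists (fun u => match u with inr k => k | inl v => of_void _ v end) => //.
  by case=> [[]|].
have := presents_reindex inr_bij (presents_mul fa eb).
by congr presents; apply: funext => -[y|[[k s]|l]].
Qed.

Lemma perm_unit f : bijective f ->
  exists2 a, units a & presents (perm_slots f) a.
Proof.
move=> bijf; have [g fK gK] := bijf.
have [a fa] := presents_exists (perm_slots_bij bijf).
have [b gb] := presents_exists (perm_slots_bij (Bijective gK fK)).
exists a => //; split; exists b; apply: presents_id_one.
- rewrite (_ : perm_slots id = g \o perm_slots f); first exact: presents_lcomp.
  by apply: funext => -[y|[[[]]|[]]] /=; rewrite fK.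
- rewrite (_ : perm_slots id = f \o perm_slots g); first exact: presents_lcomp.
  by apply: funext => -[y|[[[]]|[]]] /=; rewrite gK.
Qed.

Lemma left_unit_count a : lunits a -> exists K (e : slots X K -> X),
  presents e a /\ forall c, block_count a c = card_in X [set: K c].
Proof.
move=> /left_unit_presented[e ea]; exists (block_type a), e; split=> // c.
exact: countE ea.
Qed.

(** After the index types have been identified, two presentations with the same
    shape differ by a permutation of [X], that is, by a unit on the left. *)
Lemma count_unit_orbit a b :
  lunits a -> lunits b -> block_count a = block_count b ->
  exists2 g, units g & a = g * b.
Proof.
move=> /left_unit_count[K [e [ea Ka]]] /left_unit_count[K' [e' [eb Kb]]] ab.
have bijf c : exists f : K c -> K' c, bijective f.
  by apply/card_eqTP; apply/(card_inP _ (block_le c ea)); rewrite -Ka ab.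
have {}bijf c : {f : K c -> K' c | bijective f} by exact: cid.
pose f c := sval (bijf c).
have ff c : bijective (f c) by exact: (svalP (bijf c)).
have := presents_reindex ff eb; set e2 := (X in presents X b) => e2b.
have [bije _ _ _] := ea; have [[g e2K gK] _ _ _] := e2b.
have eg : bijective (e \o g) by apply: bij_comp bije _; exists e2.
have [u uu pu] := perm_unit eg; exists u => //.
apply: (presents_uniq ea); have := presents_lcomp pu e2b.
by congr presents; apply: funext => i /=; rewrite e2K.
Qed.

Lemma one_left_unit : lunits 1.
Proof. by exists 1; rewrite mulg1. Qed.

Lemma left_unitM a b : lunits a -> lunits b -> lunits (a * b).
Proof.
by move=> [a' aa] [b' bb]; exists (b' * a'); rewrite mulgA -(mulgA b') aa mulg1.
Qed.

Lemma count1 c : block_count (1 : brauer_graph X) c = card_in X [set: void].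
Proof. exact: countE (presents_one X). Qed.

Lemma count_mul a b (A B : Type) c : lunits a -> lunits b ->
  block_count a c = card_in X [set: A] ->
  block_count b c = card_in X [set: B] ->
  block_count (a * b) c = card_in X [set: A + B].
Proof.
move=> /left_unit_count[K [e [ea ->]]] /left_unit_count[K' [e' [eb ->]]].
move=> /(card_inP _ (block_le c ea)) KA /(card_inP _ (block_le c eb)) KB.
by rewrite (countE c (presents_mul ea eb)); apply/card_in_eq/card_sum_eq.
Qed.

Lemma count_mul_split a b (T : Type) c : lunits a -> lunits b ->
  block_count (a * b) c = card_in X [set: T] -> exists A B : Type,
  [/\ block_count a c = card_in X [set: A],
      block_count b c = card_in X [set: B] &
      [set: A + B] #= [set: T]].
Proof.
move=> /left_unit_count[K [e [ea Ka]]] /left_unit_count[K' [e' [eb Kb]]].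
have pab := presents_mul ea eb; rewrite (countE c pab).
by move=> /(card_inP _ (block_le c pab)); exists (K c), (K' c).
Qed.

(** If [a * b = 1] then [b] is a left unit as well, and the blocks of [a] are
    among those of 1. *)
Lemma unit_count a c : units a ->
  lunits a /\ block_count a c = card_in X [set: void].
Proof.
move=> [lua [b ab1]]; split=> //.
have lub : lunits b by exists a.
have := count1 c; rewrite -ab1 => /(count_mul_split lua lub)[A [B [-> _]]].
move=> /card_void AB0; apply/card_in_eq/card_void => x; exact: AB0 (inl x).
Qed.

(** There is room for any choice of h and s up to |X|: a bijection from the
    slots to [X] exists because the slots fit into four copies of [X]. *)
Lemma left_unit_exists K : (forall c, [set: K c] #<= [set: X]) ->
  exists2 a, lunits a & forall c, block_count a c = card_in X [set: K c].
Proof.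
move=> KX; suff /card_eqTP[e bije] : [set: slots X K] #= [set: X].
  have [a ea] := presents_exists bije.
  by exists a => [|c]; [exact: presents_left_unit ea|exact: countE ea].
rewrite card_eq_le; apply/andP; split; last first.
  by apply/card_leTP; exists (@through X K) => x y [].
apply: card_le_trans (card_mul_nat X_infinite).
have /card_leTP[f injf] := KX true; have /card_leTP[g injg] := KX false.
apply/card_leTP; exists (fun i : slots X K => match i with
  | inl y => (y, 0%N)
  | inr (inl (k, s)) => (f k, (s : nat).+1)
  | inr (inr l) => (g l, 3%N) end).
move=> [y|[[k s]|l]] [y'|[[k' s']|l']] //= [].
- by move=> ->.
- by move=> /injf ->; case: s s' => -[].
- by move=> _; case: s.
- by move=> _; case: s'.
- by move=> /injg ->.
Qed.

(** * Generating the left units *)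

(** The profile (c, mu) means (h, s) = (mu, 0) if [c] is true and (0, mu)
    otherwise. *)
Definition has_profile (p : bool * set (set X)) a : Prop :=
  [/\ lunits a, block_count a p.1 = p.2 &
      block_count a (~~ p.1) = card_in X [set: void]].

(** The indecomposable values of (h, s); see [generates_left_units] and
    [generating_has_profiles]. *)
Definition profiles : set (bool * set (set X)) :=
  [set p | one_or_infinite_cards X p.2].

Lemma one_or_infiniteP mu : one_or_infinite_cards X mu -> exists T : Type,
  [/\ mu = card_in X [set: T], [set: T] #<= [set: X] &
      [set: T] #= [set: unit] \/ infinite_set [set: T]].
Proof.
case=> [->|[A /infiniteP Ainf ->]].
  exists unit; split; [by []| |by left].
  have [x _] := infinite_setN0 X_infinite.
  by apply/card_leTP; exists (fun=> x) => -[] [].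
exists A; split.
- by apply/seteqP; split=> B; rewrite /card_in /= (card_eqr (card_setT A)).
- by rewrite (card_le_eql (card_setT A)); exact: card_leT.
- by right; rewrite (eq_finite_set (card_setT A)).
Qed.

Lemma infinite_one_or_infinite T : infinite_set [set: T] ->
  [set: T] #<= [set: X] -> infinite_cards X (card_in X [set: T]).
Proof.
move=> Tinf /card_leTP[f injf]; have fT := inj_card_eq (in2W injf) (A := setT).
exists (f @` setT); last first.
  by apply/seteqP; split=> B; rewrite /card_in /= (card_eqr fT).
by apply/infiniteP; rewrite (eq_finite_set fT).
Qed.

Lemma profile_neq0 mu :
  one_or_infinite_cards X mu -> mu <> card_in X [set: void].
Proof.
move=> /one_or_infiniteP[T [-> TX Tbig]] /(card_inP _ TX) T0.
case: Tbig => [|].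
  by rewrite card_eq_sym (card_eqr T0) => /card_void/(_ tt).
by apply; rewrite (eq_finite_set T0); exact: finite_finset.
Qed.

Lemma profile_exists p : profiles p -> exists a, has_profile p a.
Proof.
case: p => c mu /one_or_infiniteP[T [mT TX _]].
have [d|a lua Ka] := @left_unit_exists (fun d => if d == c then T else void).
  case: ifP => // _; apply/card_leTP.
  by exists (of_void X) => -[].
exists a; split=> //=; rewrite Ka ?eqxx ?mT //.
by case: (c).
Qed.

Lemma profile_uniq p q a : profiles p -> profiles q ->
  has_profile p a -> has_profile q a -> p = q.
Proof.
case: p q => [c mu] [d nu] pm pn [_ /= cm c0] [_ /= dn d0].
have [ecd|ncd] := eqVneq c d; first by rewrite -cm -dn ecd.
have ed : d = ~~ c by case: c d ncd {cm c0 dn d0 pm pn} => -[].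
by case: (profile_neq0 pn); rewrite -dn ed.
Qed.

(** Each of the two coordinates contributes the cardinal 1 and the rho infinite
    cardinals. *)
Lemma profiles_card : two_plus_two_rho X #= profiles.
Proof.
pose f (i : bool + bool * set (set X)) :=
  match i with inl c => (c, card_in X [set: unit]) | inr p => p end.
have injf : {in two_plus_two_rho X &, injective f}.
  have one_ninf : ~ infinite_cards X (card_in X [set: unit]).
    move=> [A /infiniteP Ainf].
    have unitX : [set: unit] #<= [set: X].
      have [x _] := infinite_setN0 X_infinite.
      by apply/card_leTP; exists (fun=> x) => -[] [].
    move=> /(card_inP _ unitX) uA; apply: Ainf.
    by rewrite -(eq_finite_set uA); exact: finite_finset.
  move=> [c|[c mu]] [d|[d nu]] /set_mem ci /set_mem di //=.
  - by move=> [->].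
  - by move=> [_ en]; rewrite -en in di.
  - by move=> [_ en]; rewrite en in ci.
  - by move=> [-> ->].
rewrite -(card_eql (inj_card_eq injf)).
rewrite (_ : f @` _ = profiles) //; apply/seteqP; split.
  by move=> _ [[c|[c mu]] ci <-]; [left|right].
move=> [c mu] [/= ->|muinf]; first by exists (inl c).
by exists (inr (c, mu)).
Qed.

Lemma generated_mul (U : set (brauer_graph X)) : subsemigroup (generated U).
Proof.
move=> x y Ux Uy A AU.
by have [+ _] := AU; apply; [exact: Ux|exact: Uy].
Qed.

Lemma generated_sub (U : set (brauer_graph X)) : U `<=` generated U.
Proof. exact: sub_gen_smallest. Qed.

(** Infinite values are the profiles themselves, and a finite value n is reached
    by the n-th power of a generator with value 1. *)
Lemma generated_pure U c (T : Type) :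
  (forall p, profiles p -> exists2 a, U a & has_profile p a) ->
  [set: T] #<= [set: X] ->
  exists2 a, generated (units `|` U) a & has_profile (c, card_in X [set: T]) a.
Proof.
move=> Uall TX; have [Tfin|Tinf] := EM (finite_set [set: T]); last first.
  have [|a Ua pa] := Uall (c, card_in X [set: T]).
    by right; exact: infinite_one_or_infinite.
  by exists a => //; apply: generated_sub; right.
have {Tfin}[n Tn] := Tfin; have {}Tn := card_eq_trans Tn (@card_II n).
rewrite (card_in_eq Tn); elim: n {Tn} => [|n [a Ga [lua /= ac ac0]]].
  exists 1; first by apply: generated_sub; left; split; exists 1; rewrite mulg1.
  split; first exact: one_left_unit.
    by rewrite count1; apply/esym/card_in_eq/card_void => -[].
  by rewrite count1.
have [|b Ub [lub /= bc bc0]] := Uall (c, card_in X [set: unit]); first by left.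
exists (a * b).
  by apply: generated_mul => //; apply: generated_sub; right.
split; first exact: left_unitM.
- rewrite (count_mul lua lub ac bc); apply: card_in_eq.
  rewrite -[n.+1](_ : #|{: 'I_n + unit}| = _)%N; last first.
    by rewrite card_sum card_ord card_unit addn1.
  by apply/card_eqTP; exists enum_rank; exact: enum_rank_bij.
- rewrite (count_mul lua lub ac0 bc0); apply/card_in_eq/card_sum_void.
  exact: card_eqxx.
Qed.

(** Any pair (h, s) is the sum of (h, 0) and (0, s), both of which are realised
    in the generated subsemigroup, and a left unit is determined by its pair up
    to a unit. *)
Lemma generates_left_units U : U `<=` lunits ->
  (forall p, profiles p -> exists2 a, U a & has_profile p a) ->
  lunits = generated (units `|` U).
Proof.
move=> Ul Uall; apply/seteqP; split; last first.
  apply: smallest_sub; first by move=> x y; exact: left_unitM.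
  by move=> x [[]|/Ul].
move=> a lua; have [K [e [ea Ka]]] := left_unit_count lua.
have [x Gx [lux /= xt xf]] := generated_pure true Uall (block_le true ea).
have [y Gy [luy /= yf yt]] := generated_pure false Uall (block_le false ea).
have [|g ug ->] := count_unit_orbit lua (left_unitM lux luy).
  apply: funext => -[]; rewrite Ka.
  - rewrite (count_mul (c := true) lux luy xt yt).
    apply/esym/card_in_eq/card_sum_void.
    exact: card_eqxx.
  - rewrite (count_mul (c := false) lux luy xf yf); apply/card_in_eq.
    apply/card_eqTP; exists inr => //.
    exists (fun u => match u with inr k => k | inl v => of_void _ v end) => //.
    by case=> [[]|].
apply: (generated_mul _ (generated_mul Gx Gy)).
by apply: generated_sub; left.
Qed.

(** If a product has profile [p], then one of its factors has profile [p]: the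
    other coordinate vanishes on both factors, and the cardinal of [p] is not a
    sum of two cardinals that both differ from it. Units do not have profile [p], so an element with
    this profile can only be generated if one is among the generators. *)
Lemma generating_has_profiles U p : U `<=` lunits ->
  lunits = generated (units `|` U) -> profiles p ->
  exists2 a, U a & has_profile p a.
Proof.
move=> Ul gU pp; have [g pg] := profile_exists pp.
pose P x := lunits x /\ (has_profile p x -> exists2 a, U a & has_profile p a).
suff /(_ g) : generated (units `|` U) `<=` P.
  by rewrite -gU => -[]; [case: pg|move=> _; apply].
apply: smallest_sub => [x y [lx Px] [ly Py]|x [ux|Ux]].
- split; first exact: left_unitM.
  have [T [mT TX Tbig]] := one_or_infiniteP pp.
  move=> [_ pxy pxy0].
  have [A [B [xA yB AB]]] := count_mul_split lx ly (etrans pxy mT).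
  have [A0 [B0 [xA0 yB0 /card_void AB0]]] := count_mul_split lx ly pxy0.
  have x0 : block_count x (~~ p.1) = card_in X [set: void].
    by rewrite xA0; apply/card_in_eq/card_void => z; exact: AB0 (inl z).
  have y0 : block_count y (~~ p.1) = card_in X [set: void].
    by rewrite yB0; apply/card_in_eq/card_void => z; exact: AB0 (inr z).
  have [AT|BT] : [set: A] #= [set: T] \/ [set: B] #= [set: T].
    case: Tbig => [T1|Tinf]; last exact: card_sum_infinite.
    by rewrite !(card_eqr T1); apply: card_sum_unit; rewrite -(card_eqr T1).
  + by apply: Px; split=> //; rewrite xA mT; exact: card_in_eq.
  + by apply: Py; split=> //; rewrite yB mT; exact: card_in_eq.
- have [lx x0] := unit_count p.1 ux; split=> // -[_ xp _].
  by case: (profile_neq0 pp); rewrite -xp.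
- by split; [exact: Ul|exists x].
Qed.

End Profiles.

Arguments profiles X : clear implicits.

Unset Implicit Arguments.

Theorem theorem4p12 (X : Type) (X_infinite : infinite_set [set: X]) :
  relative_rank_is (left_units (brauer_graph X))
    (two_sided_units (brauer_graph X)) (two_plus_two_rho X) /\
  (finite_set (infinite_cards X) ->
   forall Omega : set (brauer_graph X),
     Omega `<=` left_units (brauer_graph X) ->
     Omega #= two_plus_two_rho X ->
     (left_units (brauer_graph X) =
        generated (two_sided_units (brauer_graph X) `|` Omega) <->
      exists alpha beta : set (set X) -> brauer_graph X,
        Omega = [set alpha mu | mu in one_or_infinite_cards X] `|`
                [set beta mu | mu in one_or_infinite_cards X] /\
        forall mu, one_or_infinite_cards X mu ->
          [/\ hooks (alpha mu) = mu, singletons (beta mu) = mu,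
              singletons (alpha mu) = card_in X (@set0 X) &
              hooks (beta mu) = card_in X (@set0 X)])).
Proof.
(* The profiles are stated with [void]; the theorem uses the empty set of
   vertices. *)
have void0 : card_in X [set: void] = card_in X (@set0 X).
  apply/seteqP; split=> B;
  by rewrite /card_in /= empty_eq0 (card_eqr (card_eq00 _ X)).
have injrep (r : bool * set (set X) -> brauer_graph X) :
    (forall p, profiles X p -> has_profile p (r p)) ->
    {in profiles X &, injective r}.
  move=> rP p q /set_mem pp /set_mem pq epq.
  by apply: (profile_uniq X_infinite pp pq (rP p pp)); rewrite epq; exact: rP.
have cardrep r : (forall p, profiles X p -> has_profile p (r p)) ->
    r @` profiles X #= two_plus_two_rho X.
  move=> /injrep injr; rewrite (card_eql (inj_card_eq injr)) card_eq_sym.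
  exact: profiles_card.
have reps (U : set (brauer_graph X)) :
    (forall p, profiles X p -> exists2 a, U a & has_profile p a) ->
    exists r, forall p, profiles X p -> U (r p) /\ has_profile p (r p).
  move=> Uall; suff /choice[r rP] p :
      exists a, profiles X p -> U a /\ has_profile p a.
    by exists r.
  have [/Uall[a Ua pa]|np] := EM (profiles X p); first by exists a.
  by exists (one_brauer X).
split; first split.
- have [p /(profile_exists X_infinite)[a pa]|r rP] := reps setT.
    by exists a.
  have {}rP p pp := (rP p pp).2.
  have rl : r @` profiles X `<=` left_units (brauer_graph X).
    by move=> _ [p /rP[lr _ _] <-].
  exists (r @` profiles X); split=> //; last exact: cardrep.
  apply: generates_left_units => // p pp.
  by exists (r p); [exists p|exact: rP].
- move=> U Ul gU.
  have [p pp|r rP] := reps U; first exact: generating_has_profiles.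
  rewrite -(card_le_eql (cardrep r _)); last by move=> p /rP[].
  by apply: subset_card_le => _ [p /rP[Ur _] <-].
move=> rho_fin Omega Ol Ocard; split=> [gO|[alpha [beta [eO abP]]]].
- have [p pp|r rP] := reps Omega; first exact: generating_has_profiles.
  have Ofin : finite_set Omega.
    rewrite (eq_finite_set Ocard) (eq_finite_set (profiles_card X_infinite)).
    apply: (@sub_finite_set _ _ (setT `*` one_or_infinite_cards X)) => //.
    by apply: finite_setX => //; rewrite finite_setU; split.
  have rO : r @` profiles X = Omega.
    apply: finite_subset_card_eq Ofin _; first by move=> _ [p /rP[Ur _] <-].
    by rewrite (card_eqr Ocard); apply: cardrep => p /rP[].
  exists (fun mu => r (true, mu)), (fun mu => r (false, mu)); split.
    rewrite -rO; apply/seteqP; split.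
      by move=> _ [[[] mu] pp <-]; [left|right]; exists mu.
    by move=> _ [[mu mm <-]|[mu mm <-]]; [exists (true, mu)|exists (false, mu)].
  move=> mu mm; have [_ [_ /= ht st]] := rP (true, mu) mm.
  by have [_ [_ /= sf hf]] := rP (false, mu) mm; rewrite -void0; split.
- apply: generates_left_units => // -[c mu] mm.
  have [ha sb sa hb] := abP mu mm; case: c mm => mm.
  + exists (alpha mu); first by rewrite eO; left; exists mu.
    split=> /=; [|exact: ha|by rewrite void0].
    by apply: Ol; rewrite eO; left; exists mu.
  + exists (beta mu); first by rewrite eO; right; exists mu.
    split=> /=; [|exact: sb|by rewrite void0].
    by apply: Ol; rewrite eO; right; exists mu.
Qed.
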